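(* Let $G$ be a bipartite multigraph with a unique perfect matching, and let $D$ be its associated digraph. If $D$ is invertible, then $D^+$ is the inverse of $D$. If $G$ is invertible, then $G^+$ is the inverse of $G$ (that is, $G^+$ is an inverse of $G$, and every inverse of $G$ is isomorphic to $G^+$).
   Context: Graphs are finite, may have multiple edges between distinct vertices, and have no loops. A perfect matching is a set of edges covering each vertex exactly once (so edges of a unique perfect matching have no parallel copies). A signing matrix is a diagonal matrix with all diagonal entries $\pm1$; a matrix $X$ is signable to $Y$ if $Y=SXS$ for some signing matrix $S$. $|X|$ denotes the componentwise absolute value. A graph $H$ is an inverse of a graph $G$ if $G$ and $H$ possess adjacency matrices $A_G$, $A_H$ (for some orderings of the vertices) such that $A_H$ is signable to $A_G^{-1}$; then $G$ is called invertible. Let $G$ be bipartite on $2n$ vertices with a unique perfect matching $M$. Its vertices can be (and are) labelled $1,\dots,2n$ so that $M$ consists of the edges $\{i,n+i\}$, $1\le i\le n$, the sets $\{1,\dots,n\}$ and $\{n+1,\dots,2n\}$ are the two colour classes, and every non-matching edge joins some $i$ to some $n+j$ with $1\le i<j\le n$. The associated digraph $D$ has vertex set $\{1,\dots,n\}$ and one edge $i\to j$ for each edge of $G$ joining $i$ and $n+j$ ($i\ne j$). Let $B$ be the $n\times n$ upper unitriangular matrix with $B_{i,i}=1$ and $B_{i,j}$ the number of edges $i\to j$ of $D$ for $i\neq j$; then $G$ has adjacency matrix $A=\begin{pmatrix}0&B\\ B^T&0\end{pmatrix}$. $D$ is called invertible if there is a signing matrix $S$ with $SB^{-1}S=|B^{-1}|$.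 A digraph $E$ on $\{1,\dots,n\}$, all of whose edges $i\to j$ satisfy $i<j$, is an inverse of $D$ if the corresponding matrix $B_E$ (unit diagonal, off-diagonal entries the numbers of edges) is signable to $B^{-1}$. The parity closure $D^+$ is the digraph on $\{1,\dots,n\}$ with exactly $|B^{-1}_{i,j}|$ edges from $i$ to $j$ for each $i<j$, and $G^+$ is the graph with adjacency matrix $A^+=\begin{pmatrix}0&|(B^T)^{-1}|\\ |B^{-1}|&0\end{pmatrix}$. *)

(* Defs.v *)
From HB Require Import structures.
From mathcomp Require Import all_boot all_order all_algebra.

Set Implicit Arguments.
Unset Strict Implicit.
Unset Printing Implicit Defensive.

Import Order.TTheory GRing.Theory Num.Theory.
Local Open Scope ring_scope.

(* Finite graphs without loops; parallel edges are distinct elements of the   *)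
(* edge type with the same set of end vertices.                               *)
Record multigraph := Multigraph {
  vertex : finType;
  edge : finType;
  ends : edge -> {set vertex};
  card_ends : forall e : edge, #|ends e| = 2
}.

Arguments ends {m} _.

Definition perfect_matching (G : multigraph) (M : {set edge G}) : Prop :=
  forall v : vertex G, #|[set e in M | v \in ends e]| = 1%N.

Definition unique_perfect_matching (G : multigraph) (M : {set edge G}) : Prop :=
  perfect_matching M /\
  forall M' : {set edge G}, perfect_matching M' -> M' = M.

(* A and its complement are the colour classes of a proper 2-colouring. *)
Definition bipartition (G : multigraph) (A : {set vertex G}) : Prop :=
  forall e : edge G, #|ends e :&: A| = 1%N.

Definition bipartite (G : multigraph) : Prop :=
  exists A : {set vertex G}, bipartition A.

Definition graph_iso (G H : multigraph) : Prop :=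
  exists (phi : vertex G -> vertex H) (psi : edge G -> edge H),
    [/\ bijective phi, bijective psi
      & forall e : edge G, ends (psi e) = [set phi v | v in ends e]].

(* An ordering of the vertices is a bijection f : 'I_m -> vertex G. Diagonal  *)
(* entries are 0, since [set x; x] is a singleton.                            *)
Definition adjacency (G : multigraph) (m : nat) (f : 'I_m -> vertex G) :
    'M[rat]_m :=
  \matrix_(i, j) #|[set e : edge G | ends e == [set f i; f j]]|%:R.

Definition signing_matrix (R : pzRingType) (m : nat) (S : 'M[R]_m) : Prop :=
  exists2 d : 'rV[R]_m,
    S = diag_mx d & forall i : 'I_m, d 0 i = 1 \/ d 0 i = -1.

Definition signable (R : pzRingType) (m : nat) (X Y : 'M[R]_m) : Prop :=
  exists2 S : 'M[R]_m, signing_matrix S & Y = S *m X *m S.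

Definition abs_mx (R : numDomainType) (m p : nat) (X : 'M[R]_(m, p)) :
    'M[R]_(m, p) :=
  map_mx (fun x => `|x|) X.

Definition inverse_graph (G H : multigraph) : Prop :=
  exists (m : nat) (f : 'I_m -> vertex G) (h : 'I_m -> vertex H),
    [/\ bijective f, bijective h, adjacency f \in unitmx
      & signable (adjacency h) (invmx (adjacency f))].

Definition invertible_graph (G : multigraph) : Prop :=
  exists H : multigraph, inverse_graph G H.

(* Digraphs on the vertex set 'I_n, with parallel edges allowed: the entry    *)
(* (i, j) is the number of edges i -> j.                                      *)
Definition digraph (n : nat) : Type := 'M[nat]_n.

(* For a digraph with all edges i -> j satisfying i < j this matrix is upper   *)
(* unitriangular, so its inverse exists over int.                             *)
Definition digraph_mx (n : nat) (D : digraph n) : 'M[int]_n :=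
  \matrix_(i, j) if i == j then 1 else (D i j)%:Z.

Definition invertible_digraph (n : nat) (D : digraph n) : Prop :=
  exists2 S : 'M[int]_n, signing_matrix S &
    S *m invmx (digraph_mx D) *m S = abs_mx (invmx (digraph_mx D)).

Definition forward (n : nat) (E : digraph n) : Prop :=
  forall i j : 'I_n, (0 < E i j)%N -> (i < j)%N.

Definition inverse_digraph (n : nat) (D E : digraph n) : Prop :=
  forward E /\ signable (digraph_mx E) (invmx (digraph_mx D)).

Definition digraph_plus (n : nat) (D : digraph n) : digraph n :=
  \matrix_(i, j) if (i < j)%N then `|invmx (digraph_mx D) i j|%N else 0%N.

(* The vertices 1, ..., n are the f (lshift n i), and n+1, ..., 2n are the    *)
(* f (rshift n i).                                                            *)
Definition matching_labelling (G : multigraph) (M : {set edge G}) (n : nat)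
    (f : 'I_(n + n) -> vertex G) : Prop :=
  [/\ bijective f,
      [set ends e | e in M] =
        [set [set f (lshift n i); f (rshift n i)] | i : 'I_n],
      bipartition [set f (lshift n i) | i : 'I_n]
    & forall e : edge G, e \notin M ->
        exists i j : 'I_n,
          (i < j)%N /\ ends e = [set f (lshift n i); f (rshift n j)]].

Definition assoc_digraph (G : multigraph) (n : nat)
    (f : 'I_(n + n) -> vertex G) : digraph n :=
  \matrix_(i, j)
    if i == j then 0%N
    else #|[set e : edge G | ends e == [set f (lshift n i); f (rshift n j)]]|.

Section GraphOfMatrix.

Variables (m : nat) (A : 'M[nat]_m).

(* One edge for each pair i < j and each k < A i j; only the strict upper     *)
(* triangle of A is used.                                                     *)
Definition mx_edge : finType :=
  {p : {ij : 'I_m * 'I_m | (ij.1 < ij.2)%N} & 'I_(A (val p).1 (val p).2)}.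

Definition mx_ends (e : mx_edge) : {set 'I_m} :=
  [set (val (tag e)).1; (val (tag e)).2].

Fact card_mx_ends (e : mx_edge) : #|mx_ends e| = 2.
Proof.
by rewrite cards2; case: (tag e) => -[i j] /= ltij; rewrite neq_ltn ltij.
Qed.

Definition graph_of_mx : multigraph := Multigraph card_mx_ends.

Lemma adjacency_graph_of_mx :
    A^T = A -> (forall i, A i i = 0%N) ->
  @adjacency graph_of_mx m id = map_mx (GRing.natmul 1) A.
Proof.
move=> symA diagA.
have ltE (i j : 'I_m) : (i < j)%N ->
    #|[set e : mx_edge | mx_ends e == [set i; j]]| = A i j.
  move=> ltij; pose p : {ij : 'I_m * 'I_m | (ij.1 < ij.2)%N} :=
    exist (fun ij : 'I_m * 'I_m => (ij.1 < ij.2)%N) (i, j) ltij.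
  pose g (k : 'I_(A i j)) : mx_edge :=
    existT (fun q : {ij : 'I_m * 'I_m | (ij.1 < ij.2)%N} =>
              'I_(A (val q).1 (val q).2)) p k.
  have injg : injective g by move=> k l /eqP; rewrite eq_Tagged => /eqP.
  rewrite -[RHS]card_ord -(card_imset _ injg); apply: eq_card => e.
  rewrite !inE; apply/eqP/imsetP => [|[k _ ->] //].
  case: e => [[[a b] ltab] k]; rewrite /mx_ends /= => Eab.
  have [Ea Eb] : a = i /\ b = j.
    have := set21 a b; have := set22 a b; rewrite Eab !inE.
    move=> /orP[] /eqP Eb /orP[] /eqP Ea //; subst a b;
      by move: (ltab); rewrite /= ?ltnn // ltnNge ltnW.
  subst a b; have Ep : ltab = ltij by apply: bool_irrelevance.
  by subst ltab; exists k.
apply/matrixP => i j; rewrite !mxE; congr (_%:R) => /=.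
case: (ltngtP i j) => [|ltji|/val_inj ->]; first exact: ltE.
  have -> : A i j = A j i by rewrite -{1}symA mxE.
  rewrite -(ltE _ _ ltji); apply: eq_card => e.
  by rewrite !inE [in RHS]setUC.
rewrite diagA; apply: eq_card0 => e; rewrite !inE; apply/negP => /eqP Ee.
by have := card_mx_ends e; rewrite Ee cards2 eqxx.
Qed.

End GraphOfMatrix.

Definition plus_mx (n : nat) (D : digraph n) : 'M[nat]_(n + n) :=
  block_mx (const_mx 0%N) (map_mx absz (invmx (digraph_mx D)^T))
           (map_mx absz (invmx (digraph_mx D))) (const_mx 0%N).

Definition graph_plus (n : nat) (D : digraph n) : multigraph :=
  graph_of_mx (plus_mx D).

Lemma adjacency_graph_plus (n : nat) (D : digraph n) :
  @adjacency (graph_plus D) (n + n) id = map_mx (GRing.natmul 1) (plus_mx D).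
Proof.
apply: adjacency_graph_of_mx => [|i].
  by rewrite /plus_mx tr_block_mx !trmx_const !map_trmx !trmx_inv trmxK.
by rewrite -(splitK i); case: (split i) => k /=;
   rewrite /plus_mx ?block_mxEul ?block_mxEdr mxE.
Qed.

(* Main.v *)
Require Import Defs.
From mathcomp Require Import all_boot all_order all_algebra.

(** Signing changes no absolute value, so a nonnegative matrix signable to [Y]
can only be [|Y|] ([signable_abs]). An inverse of [D] therefore has matrix
[|B^-1|], and every inverse of [G] has adjacency matrix [|A^-1|] for an
ordering of its vertices; this is where uniqueness comes from. The rest
identifies these two matrices with those of [D^+] and [G^+].

For [D^+], the inverse of an upper unitriangular matrix is upper unitriangular
([invmx_unitriangular]), so that the strict upper triangle of [|B^-1|]
determines it. For [G^+], the labelling gives [A] the blocks [0, B, B^T, 0]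
([adjacency_labelling]), and [A^-1] has the blocks [0, (B^T)^-1, B^-1, 0].

The definition of an inverse graph allows any ordering of the vertices of [G];
simultaneous permutation of rows and columns commutes with inversion and with
signing, so the ordering may be taken to be the given labelling
([inverse_graph_ordering]). Invertibility of [G] then provides the signing that
makes [G^+] an inverse, and two graphs with equal adjacency matrices are
isomorphic ([adjacency_inj_iso]). *)

Set Implicit Arguments.
Unset Strict Implicit.
Unset Printing Implicit Defensive.

Import Order.TTheory GRing.Theory Num.Theory.
Local Open Scope ring_scope.

(** * Signable matrices *)

Lemma signableP (R : pzRingType) (m : nat) (X Y : 'M[R]_m) :
  signable X Y <->
  exists2 d : 'rV[R]_m, (forall i, d 0 i = 1 \/ d 0 i = -1)
    & forall i j, Y i j = d 0 i * X i j * d 0 j.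
Proof.
split=> [[_ [d -> hd] ->]|[d hd hY]].
  by exists d => // i j; rewrite mul_mx_diag mxE mul_diag_mx mxE.
exists (diag_mx d); first by exists d.
by apply/matrixP=> i j; rewrite mul_mx_diag mxE mul_diag_mx mxE.
Qed.

Lemma signable_sym (R : pzRingType) (m : nat) (X Y : 'M[R]_m) :
  signable X Y -> signable Y X.
Proof.
move=> /signableP[d hd hY]; apply/signableP; exists d => // i j.
have dd k : d 0 k * d 0 k = 1 by case: (hd k) => ->; rewrite ?mulrNN mulr1.
by rewrite hY !mulrA dd mul1r -mulrA dd mulr1.
Qed.

Lemma signable_abs (R : numDomainType) (m : nat) (X Y : 'M[R]_m) :
  (forall i j, 0 <= X i j) -> signable X Y -> X = abs_mx Y.
Proof.
move=> X_ge0 /signableP[d hd hY].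
have nd k : `|d 0 k| = 1 by case: (hd k) => ->; rewrite ?normrN normr1.
by apply/matrixP=> i j; rewrite mxE hY !normrM !nd mul1r mulr1 ger0_norm.
Qed.

Lemma signable_mxsub (R : pzRingType) (m p : nat) (s : 'I_p -> 'I_m)
    (X Y : 'M[R]_m) :
  signable X Y -> signable (mxsub s s X) (mxsub s s Y).
Proof.
move=> /signableP[d hd hY]; apply/signableP.
by exists (colsub s d) => [i|i j]; rewrite !mxE.
Qed.

(** * Inverses of matrices *)

Lemma invmx_uniq (R : comUnitRingType) (m : nat) (A C : 'M[R]_m) :
  A *m C = 1%:M -> invmx A = C.
Proof.
move=> AC; have [Au _] := mulmx1_unit AC.
by rewrite -[LHS]mulmx1 -AC mulKmx.
Qed.

Lemma mulmx_mxsub_invmx (R : comUnitRingType) (m p : nat) (s : 'I_p -> 'I_m)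
    (A : 'M[R]_m) :
  bijective s -> A \in unitmx ->
  mxsub s s A *m mxsub s s (invmx A) = 1%:M.
Proof.
move=> bij_s Au; apply/matrixP=> i j.
rewrite !mxE -(inj_eq (bij_inj bij_s) i j).
have <- : (A *m invmx A) (s i) (s j) = (s i == s j)%:R.
  by rewrite mulmxV // mxE.
rewrite mxE [RHS](reindex s) /=; last exact: onW_bij.
by apply: eq_bigr => k _; rewrite !mxE.
Qed.

Definition upper_unitriangular (R : pzSemiRingType) (n : nat) (B : 'M[R]_n) :=
  forall i j : 'I_n, (j <= i)%N -> B i j = (i == j)%:R.

Lemma unitmx_unitriangular (R : comUnitRingType) (n : nat) (B : 'M[R]_n) :
  upper_unitriangular B -> B \in unitmx.
Proof.
move=> uB; rewrite unitmxE -det_tr det_trig.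
  by rewrite big1 ?unitr1 // => i _; rewrite mxE uB // eqxx.
apply/is_trig_mxP=> i j ltij; rewrite mxE uB 1?ltnW //.
by rewrite -val_eqE gtn_eqF.
Qed.

(** Induction on the column [j]: in the equation [B^-1 B = 1] read at [(i, j)]
with [j <= i], the terms [B^-1 i l * B l j] vanish for [l < j] by induction and
for [j < l] by triangularity of [B], which leaves [B^-1 i j]. *)
Lemma invmx_unitriangular (R : comUnitRingType) (n : nat) (B : 'M[R]_n) :
  upper_unitriangular B -> upper_unitriangular (invmx B).
Proof.
move=> uB i j; have [k] := ubnP (val j).
elim: k j => // k IH j /ltnSE lejk leji.
have := congr1 (fun X : 'M_n => X i j) (mulVmx (unitmx_unitriangular uB)).
rewrite [LHS]mxE [RHS]mxE (bigD1 j) //= uB // eqxx mulr1 big1 ?addr0 // => l.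
rewrite neq_ltn => /orP[ltlj|ltjl].
  have ltli := leq_trans ltlj leji.
  by rewrite IH ?(leq_trans ltlj) ?(ltnW ltli) // -val_eqE gtn_eqF // mul0r.
by rewrite uB ?(ltnW ltjl) // -val_eqE gtn_eqF // mulr0.
Qed.

(** * Inverses of digraphs *)

Lemma digraph_mx_ge0 (n : nat) (D : digraph n) i j : 0 <= digraph_mx D i j.
Proof. by rewrite mxE; case: eqP. Qed.

Lemma inverse_digraph_abs (n : nat) (D E : digraph n) :
  inverse_digraph D E -> digraph_mx E = abs_mx (invmx (digraph_mx D)).
Proof. by case=> _ /signable_abs -> // i j; apply: digraph_mx_ge0. Qed.

Lemma inverse_digraph_uniq (n : nat) (D E : digraph n) :
  inverse_digraph D E -> E = digraph_plus D.
Proof.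
move=> invE; have [fwE _] := invE; apply/matrixP=> i j; rewrite mxE.
case: ifP => [ltij|/negbT nltij]; last first.
  by apply/eqP; rewrite -leqn0 leqNgt; apply: contra nltij => /fwE.
have := congr1 (fun X : 'M_n => X i j) (inverse_digraph_abs invE).
rewrite [LHS]mxE [RHS]mxE -val_eqE (ltn_eqF ltij) => Eij.
by apply/eqP; rewrite -eqz_nat Eij abszE.
Qed.

Lemma digraph_mx_plus (n : nat) (D : digraph n) :
  upper_unitriangular (digraph_mx D) ->
  digraph_mx (digraph_plus D) = abs_mx (invmx (digraph_mx D)).
Proof.
move=> /invmx_unitriangular uC; apply/matrixP=> i j; rewrite !mxE.
case: (ltngtP i j) => [ltij|ltji|/val_inj ->]; last by rewrite uC ?eqxx ?normr1.
  by rewrite -val_eqE ltn_eqF //= abszE.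
by rewrite uC 1?ltnW // -val_eqE gtn_eqF //= normr0.
Qed.

Lemma inverse_digraph_plus (n : nat) (D : digraph n) :
  upper_unitriangular (digraph_mx D) -> invertible_digraph D ->
  inverse_digraph D (digraph_plus D).
Proof.
move=> uD [S hS absE]; split.
  by move=> i j; rewrite mxE; case: ifP.
by rewrite digraph_mx_plus // -absE; apply: signable_sym; exists S.
Qed.

(** * Graphs with equal adjacency matrices *)

(** The [k]-th element of each fibre of [a] goes to the [k]-th element of the
fibre of [b] over the same point. *)
Lemma fibre_injection (E F : finType) (T : eqType) (a : E -> T) (b : F -> T) :
    (forall t, #|[set x | a x == t]| <= #|[set y | b y == t]|)%N ->
  exists2 psi : E -> F, injective psi & forall x, b (psi x) = a x.
Proof.
move=> le_fib.
pose rk (K : finType) (c : K -> T) x := index x (enum [set y | c y == c x]).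
have fib x : exists y, b y = a x /\ rk F b y = rk E a x.
  set s := enum [set y | b y == a x].
  have ltx : (rk E a x < size s)%N.
    rewrite -cardE; apply: leq_trans (le_fib (a x)).
    by rewrite [leqRHS]cardE index_mem mem_enum inE.
  have [y0 _] : {y0 | y0 \in s}.
    by case: s ltx => // y s _; exists y; rewrite mem_head.
  have := mem_nth y0 ltx; rewrite mem_enum inE => /eqP by_.
  by exists (nth y0 s (rk E a x)); rewrite /rk by_ index_uniq ?enum_uniq.
have [psi psiP] := fin_all_exists fib.
exists psi => [x x' eq_psi|x]; last by case: (psiP x).
have [bx rx] := psiP x; have [bx' rx'] := psiP x'.
have eq_a : a x = a x' by rewrite -bx -bx' eq_psi.
have : rk E a x = rk E a x' by rewrite -rx -rx' eq_psi.
by rewrite /rk eq_a => /index_inj-> //; rewrite mem_enum inE ?eq_a.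
Qed.

Lemma fibre_bijection (E F : finType) (T : eqType) (a : E -> T) (b : F -> T) :
    (forall t, #|[set x | a x == t]| = #|[set y | b y == t]|) ->
  exists2 psi : E -> F, bijective psi & forall x, b (psi x) = a x.
Proof.
move=> eq_fib.
have [|psi inj_psi psiE] := @fibre_injection E F T a b.
  by move=> t; rewrite eq_fib.
have [|chi inj_chi _] := @fibre_injection F E T b a.
  by move=> t; rewrite eq_fib.
by exists psi => //; apply: inj_card_bij (leq_card _ inj_chi).
Qed.

(** Equal adjacency matrices mean that [phi := h \o f^-1] preserves the number
of edges with a given set of ends, so the edges can be matched accordingly. *)
Lemma adjacency_inj_iso (G H : multigraph) (m : nat)
    (f : 'I_m -> vertex G) (h : 'I_m -> vertex H) :
  bijective f -> bijective h -> adjacency f = adjacency h -> graph_iso G H.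
Proof.
move=> [f' fK f'K] bij_h eq_adj.
have bij_phi : bijective (h \o f').
  by apply: bij_comp bij_h _; exists f.
have inj_phi := bij_inj bij_phi.
have [//|psi bij_psi psiE] := @fibre_bijection (edge G) (edge H) _
  (fun e => (h \o f') @: ends e) ends; last by exists (h \o f'), psi.
move=> U; have [phi' phiK phi'K] := bij_phi.
have {phi'K} -> : U = (h \o f') @: (phi' @: U).
  by rewrite -imset_comp (eq_imset _ phi'K) imset_id.
move: (phi' @: U) => {}U.
have -> : [set e : edge G | (h \o f') @: ends e == (h \o f') @: U]
          = [set e | ends e == U].
  by apply/setP=> e; rewrite !inE (inj_eq (imset_inj inj_phi)).
(* Only the sets of two vertices can be sets of ends, and these are the ones
   whose edges an entry of the adjacency matrix counts. *)
have [cU|cU] := boolP (#|U| == 2).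
  case/cards2P: cU => x [y [_ ->]].
  have := congr1 (fun X : 'M_m => X (f' x) (f' y)) eq_adj.
  by rewrite !mxE !f'K imsetU1 imset_set1 => /eqP; rewrite eqr_nat => /eqP.
rewrite !eq_card0 // => e; rewrite !inE; apply: contraNF cU => /eqP eU.
  by rewrite -(card_imset _ inj_phi) -eU card_ends.
by rewrite -eU card_ends.
Qed.

(** * Inverses of graphs *)

Lemma adjacency_comp (G : multigraph) (m p : nat) (g : 'I_m -> vertex G)
    (s : 'I_p -> 'I_m) :
  adjacency (g \o s) = mxsub s s (adjacency g).
Proof. by apply/matrixP=> i j; rewrite !mxE. Qed.

(** The orderings [g] and [h] witnessing the inverse are both precomposed with
[g^-1 \o f], which turns [g] into [f]. *)
Lemma inverse_graph_ordering (G H : multigraph) (p : nat)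
    (f : 'I_p -> vertex G) :
  bijective f -> inverse_graph G H ->
  exists2 h : 'I_p -> vertex H, bijective h
    & adjacency f \in unitmx /\ signable (adjacency h) (invmx (adjacency f)).
Proof.
move=> bij_f [m [g [h [[g' gK g'K] bij_h Au sgn]]]].
have bij_s : bijective (g' \o f) by apply: bij_comp bij_f; exists g.
have -> : adjacency f = mxsub (g' \o f) (g' \o f) (adjacency g).
  by rewrite -adjacency_comp; apply/matrixP=> i j; rewrite !mxE /= !g'K.
have VA := mulmx_mxsub_invmx bij_s Au.
exists (h \o (g' \o f)); first exact: bij_comp.
split; first by case: (mulmx1_unit VA).
by rewrite (invmx_uniq VA) adjacency_comp; apply: signable_mxsub.
Qed.

Lemma inverse_graph_abs (G H : multigraph) (p : nat) (f : 'I_p -> vertex G) :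
  bijective f -> inverse_graph G H ->
  exists2 h : 'I_p -> vertex H, bijective h
    & adjacency h = abs_mx (invmx (adjacency f)).
Proof.
move=> bij_f /(inverse_graph_ordering bij_f)[h bij_h [_ sgn]].
by exists h => //; apply: signable_abs sgn => i j; rewrite mxE ler0n.
Qed.

(** * The labelling of a bipartite graph by its perfect matching *)

Section Labelling.

Variables (G : multigraph) (M : {set edge G}) (n : nat).
Variable f : 'I_(n + n) -> vertex G.
Hypotheses (hM : perfect_matching M) (hf : matching_labelling M f).

Let fl i := f (lshift n i).
Let fr i := f (rshift n i).

Lemma labelling_inj : injective f.
Proof. by case: hf => /bij_inj. Qed.

Lemma ends_lr_inj i j k l :
  [set fl i; fr j] = [set fl k; fr l] -> i = k /\ j = l.
Proof.
move=> eq_set; split.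
  have := set21 (fl i) (fr j); rewrite eq_set !inE !(inj_eq labelling_inj).
  by rewrite eq_lrshift orbF => /eqP/lshift_inj.
have := set22 (fl i) (fr j); rewrite eq_set !inE !(inj_eq labelling_inj).
by rewrite eq_rlshift => /eqP/rshift_inj.
Qed.

Lemma ends_ll_false e i j : ends e = [set fl i; fl j] -> False.
Proof.
case: hf => _ _ bip _ Ee; have := bip e; rewrite (setIidPl _) ?card_ends //.
rewrite Ee; apply/subsetP=> x /set2P[]->; exact: imset_f.
Qed.

Lemma ends_rr_false e i j : ends e = [set fr i; fr j] -> False.
Proof.
case: hf => _ _ bip _ Ee; have := bip e; rewrite Ee.
rewrite (_ : _ :&: _ = set0) ?cards0 //; apply/setP=> x; rewrite !inE.
apply/andP=> -[/orP[]/eqP-> /imsetP[k _ /labelling_inj/eqP]];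
  by rewrite eq_rlshift.
Qed.

Lemma matching_ends_lr e i j :
  e \in M -> ends e = [set fl i; fr j] -> i = j.
Proof.
case: hf => _ EM _ _ eM Ee.
have : ends e \in [set ends e | e in M] by apply: imset_f.
by rewrite EM => /imsetP[k _]; rewrite Ee => /ends_lr_inj[-> ->].
Qed.

Lemma ends_lr_le e i j :
  ends e = [set fl i; fr j] -> if e \in M then i = j else (i < j)%N.
Proof.
move=> Ee; case: ifPn => [eM|enM]; first exact: matching_ends_lr Ee.
case: hf => _ _ _ /(_ _ enM)[k [l [ltkl]]].
by rewrite Ee => /ends_lr_inj[-> ->].
Qed.

(** An edge joining [i] to [n + i] lies in [M], since edges outside [M] go
strictly forward, and [M] has only one edge at
the vertex [i]. *)
Lemma card_ends_matched i :
  #|[set e : edge G | ends e == [set fl i; fr i]]| = 1%N.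
Proof.
rewrite -(hM (fl i)); apply: eq_card => e; rewrite !inE.
apply/eqP/andP=> [Ee|[eM]].
  by have := ends_lr_le Ee; rewrite ltnn Ee set21; case: ifP.
have : ends e \in [set ends e | e in M] by apply: imset_f.
case: hf => _ -> _ _ /imsetP[k _ ->]; rewrite !inE !(inj_eq labelling_inj).
by rewrite eq_lrshift orbF => /eqP/lshift_inj->.
Qed.

Lemma digraph_mx_assoc i j :
  digraph_mx (assoc_digraph f) i j
  = #|[set e : edge G | ends e == [set fl i; fr j]]|%:Z.
Proof.
by rewrite !mxE; case: eqVneq => [->|//]; rewrite card_ends_matched.
Qed.

Lemma assoc_unitriangular : upper_unitriangular (digraph_mx (assoc_digraph f)).
Proof.
move=> i j leji; rewrite digraph_mx_assoc.
have [->|neij] := eqVneq i j; first by rewrite card_ends_matched.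
rewrite eq_card0 // => e; rewrite !inE; apply/eqP=> /ends_lr_le.
by case: ifP => _; [apply/eqP | rewrite ltnNge leji].
Qed.

Lemma adjacency_labelling :
  let B := map_mx intr (digraph_mx (assoc_digraph f)) in
  adjacency f = block_mx 0 B B^T 0.
Proof.
apply/matrixP=> i j; rewrite mxE.
case: (split_ordP i) => k ->; case: (split_ordP j) => l ->.
- rewrite block_mxEul mxE eq_card0 // => e; rewrite !inE.
  by apply/eqP=> /ends_ll_false.
- by rewrite block_mxEur mxE digraph_mx_assoc.
- by rewrite block_mxEdl mxE mxE digraph_mx_assoc setUC.
- rewrite block_mxEdr mxE eq_card0 // => e; rewrite !inE.
  by apply/eqP=> /ends_rr_false.
Qed.

Lemma adjacency_plus_abs :
  @adjacency (graph_plus (assoc_digraph f)) (n + n) id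
  = abs_mx (invmx (adjacency f)).
Proof.
have := assoc_unitriangular; rewrite adjacency_graph_plus adjacency_labelling.
move: (assoc_digraph f) => D /unitmx_unitriangular uB.
set B := digraph_mx D in uB *; set C : 'M[rat]_n := map_mx intr (invmx B).
have BC : map_mx intr B *m C = 1%:M.
  by rewrite -map_mxM mulmxV // map_mx1.
have CB : C *m map_mx intr B = 1%:M.
  by rewrite -map_mxM mulVmx // map_mx1.
rewrite (@invmx_uniq _ _ _ (block_mx 0 C^T C 0)); last first.
  rewrite mulmx_block !mul0mx !mulmx0 !addr0 !add0r BC -trmx_mul CB trmx1.
  by rewrite -scalar_mx_block.
rewrite /plus_mx /abs_mx !map_block_mx -trmx_inv; congr block_mx;
  apply/matrixP=> i j; rewrite !mxE ?normr0 //; by rewrite -intr_norm -abszE.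
Qed.

End Labelling.

Theorem theorem2p5 (G : multigraph) (M : {set edge G}) (n : nat)
    (f : 'I_(n + n) -> vertex G)
    (hbip : bipartite G) (hM : unique_perfect_matching M)
    (hf : matching_labelling M f) :
  (invertible_digraph (assoc_digraph f) ->
     inverse_digraph (assoc_digraph f) (digraph_plus (assoc_digraph f)) /\
     (forall E : digraph n, inverse_digraph (assoc_digraph f) E ->
        E = digraph_plus (assoc_digraph f))) /\
  (invertible_graph G ->
     inverse_graph G (graph_plus (assoc_digraph f)) /\
     (forall H : multigraph, inverse_graph G H ->
        graph_iso H (graph_plus (assoc_digraph f)))).
Proof.
have [pM _] := hM; have [bij_f _ _ _] := hf.
have bij_id : bijective (@id 'I_(n + n)) by exists id.
have plusE := adjacency_plus_abs pM hf.
split=> [invD|[H invH]]; split.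
- exact: inverse_digraph_plus (assoc_unitriangular pM hf) invD.
- exact: inverse_digraph_uniq.
- have [h _ [Au sgn]] := inverse_graph_ordering bij_f invH.
  exists (n + n)%N, f, id; split=> //; rewrite plusE -(signable_abs _ sgn) //.
  by move=> i j; rewrite mxE ler0n.
move=> {H invH} H /(inverse_graph_abs bij_f)[h bij_h absE].
pose Gplus := graph_plus (assoc_digraph f).
apply: (@adjacency_inj_iso H Gplus _ h id bij_h bij_id).
by rewrite plusE.
Qed.
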